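(* Let $G$ and $H$ be F-cores. If $(G,H)$ is an F-gap, then $G$ is isomorphic to a graph obtained from $H$ by removing one vertex. Consequently, for F-cores $G$ and $H$, $(G,H)$ is a gap in the full homomorphism order if and only if $(G,H)$ is a gap in the embedding order.
   Context: Graphs are finite directed graphs with loops allowed. A full homomorphism $f:G\to H$ is a map $f:V_G\to V_H$ such that $(u,v)\in E_G\iff (f(u),f(v))\in E_H$ for all $u,v\in V_G$; an embedding is an injective full homomorphism. $G\leq^F H$ (resp. $G\leq^E H$) means that there is a full homomorphism (resp. an embedding) from $G$ to $H$. The full homomorphism order is the order induced by $\leq^F$ on finite directed graphs up to the equivalence $G\leq^F H\leq^F G$; the embedding order is the order induced by $\leq^E$ on isomorphism classes of finite directed graphs. An F-core is a graph with the minimum number of vertices in its equivalence class for $\leq^F$. A gap in an order is a pair $(x,y)$ with $x<y$ such that no $z$ satisfies $x<z<y$; an F-gap is a gap in the full homomorphism order. Removing a vertex means passing to the subgraph induced by the remaining vertices. *)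

(* Defs.v *)
From mathcomp Require Import all_boot.
Set Implicit Arguments.
Unset Strict Implicit.
Unset Printing Implicit Defensive.

(* Loops are allowed, and so is the graph without vertices. *)
Record digraph : Type := Digraph { vertex :> finType; edge : rel vertex }.

Definition full_hom (G H : digraph) (f : G -> H) : Prop :=
  forall u v : G, edge u v = edge (f u) (f v).

Definition embedding (G H : digraph) (f : G -> H) : Prop :=
  injective f /\ full_hom f.

Definition isomorphic (G H : digraph) : Prop :=
  exists f : G -> H, bijective f /\ full_hom f.

Definition leF (G H : digraph) : Prop := exists f : G -> H, full_hom f.

Definition leE (G H : digraph) : Prop := exists f : G -> H, embedding f.

Definition eqF (G H : digraph) : Prop := leF G H /\ leF H G.

Definition F_core (G : digraph) : Prop :=
  forall H : digraph, eqF G H -> #|G| <= #|H|.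

(* Gaps in the order induced by [le] on the classes of [eqv], expressed on
   representatives: [x] lies strictly below [y] when [le x y] holds and the
   classes of [x] and [y] differ. *)
Definition class_lt (T : Type) (eqv le : T -> T -> Prop) (x y : T) : Prop :=
  le x y /\ ~ eqv x y.

Definition class_gap (T : Type) (eqv le : T -> T -> Prop) (x y : T) : Prop :=
  class_lt eqv le x y /\
  ~ (exists z : T, class_lt eqv le x z /\ class_lt eqv le z y).

Definition F_gap : digraph -> digraph -> Prop := class_gap eqF leF.

Definition E_gap : digraph -> digraph -> Prop := class_gap isomorphic leE.

Definition induced (G : digraph) (A : {set G}) : digraph :=
  @Digraph {u : G | u \in A} (fun u v => edge (val u) (val v)).

Definition remove_vertex (G : digraph) (x : G) : digraph :=
  induced [set~ x].

(* Main.v *)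
Require Import Defs.
From mathcomp Require Import all_boot.
Set Implicit Arguments.
Unset Strict Implicit.
Unset Printing Implicit Defensive.

(** An F-core has no twins (distinct vertices with the same in- and
    out-neighbours), so full homomorphisms out of it are injective. Let
    [G < H] be F-cores and let [S] be the set of the vertices [x] such that [G]
    maps to [H - x]. If [a], [b] are twins in [H - v] with [v] in [S], then
    [H - v] retracts onto [H - v - a] and onto [H - v - b], so that [a] and [b]
    are in [S]. Bondy's theorem on the adjacency rows of the vertices of [S]
    gives [v] in [S] such that no two vertices of [S] agree off [v]; hence
    [H - v] has no twins, and [G <= H - v < H]. *)

(** Bondy's theorem. Were every column [v] in [B] needed to separate two rows,
    then blanking the columns of [B] one at a time would each time lower the
    number of distinct rows, down to none, as [#|A| <= #|B|]. *)
Lemma bondy (I J C : finType) (r : I -> J -> C) (A : {set I}) (B : {set J}) :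
  0 < #|A| <= #|B| -> {in A &, forall a b, r a =1 r b -> a = b} ->
  exists2 v, v \in B &
    {in A &, forall a b, (forall u, u != v -> r a u = r b u) -> a = b}.
Proof.
move=> /andP[A_gt0 leAB] r_inj.
pose bad v := [exists a in A, exists b in A,
  (a != b) && [forall (u | u != v), r a u == r b u]].
have [/exists_inP[v Bv good_v]|all_bad] :=
  boolP [exists v in B, ~~ bad v].
  exists v => // a b Aa Ab agree; apply/eqP; apply: contraNT good_v => neq_ab.
  apply/exists_inP; exists a => //; apply/exists_inP; exists b => //.
  by rewrite neq_ab; apply/forall_inP => u /agree->.
pose row (s : seq J) a := [ffun u => if u \in s then None else Some (r a u)].
have few_rows s : uniq s -> {subset s <= B} -> #|row s @: A| + size s <= #|A|.
  elim: s => [|v s IHs] /=; first by rewrite addn0 leq_imset_card.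
  case/andP=> s'v uniq_s sB.
  have {IHs} := IHs uniq_s (fun u su => sB u (mem_behead (s := v :: s) su)).
  apply: leq_trans; rewrite addnS ltn_add2r.
  pose blank (g : {ffun J -> option C}) := [ffun u => if u == v then None else g u].
  have row_cons a : row (v :: s) a = blank (row s a).
    by apply/ffunP => u; rewrite !ffunE inE; case: eqP.
  have -> : row (v :: s) @: A = blank @: (row s @: A).
    by rewrite -imset_comp; apply: eq_imset.
  (* Equal cardinals would make [blank] injective on the rows. Two rows that agree off [v] coincide
     once [v] is blanked, so they would also agree at [v], still visible because [v] is not in
     [s]. *)
  rewrite ltn_neqAle leq_imset_card andbT; apply/imset_injP => blank_inj.
  move: all_bad; rewrite negb_exists_in => /forall_inP/(_ v).
  rewrite sB ?mem_head // negbK => /(_ isT).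
  case/exists_inP=> a Aa /exists_inP[b Ab /andP[/eqP neq_ab /forall_inP agree]].
  apply: neq_ab; apply: r_inj => // u; have [->|/agree/eqP//] := eqVneq u v.
  have /ffunP/(_ v) : row s a = row s b.
    apply: blank_inj; rewrite ?imset_f // -!row_cons.
    apply/ffunP => w; rewrite !ffunE inE; case: eqVneq => //= /agree/eqP->.
    by [].
  by rewrite !ffunE (negPf s'v) => -[].
(* With all of [B] blanked, a row still remains since [A] is nonempty, so [#|B| < #|A|]. *)
have := few_rows (enum B) (enum_uniq _) (fun u => etrans (esym (mem_enum B u))).
rewrite -cardE leqNgt => /negP[]; rewrite -add1n leq_add // card_gt0.
by apply: contraTneq A_gt0 => /eqP; rewrite imset_eq0 => /eqP->; rewrite cards0.
Qed.

Definition twins (G : digraph) (u v : G) : Prop :=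
  forall w : G, edge u w = edge v w /\ edge w u = edge w v.

Definition twin_free (G : digraph) : Prop := forall u v : G, twins u v -> u = v.

Lemma full_hom_comp (G H K : digraph) (f : G -> H) (g : H -> K) :
  full_hom f -> full_hom g -> full_hom (g \o f).
Proof. by move=> hf hg u v; rewrite hf hg. Qed.

Lemma leF_trans (G H K : digraph) : leF G H -> leF H K -> leF G K.
Proof. by move=> [f hf] [g hg]; exists (g \o f); apply: full_hom_comp. Qed.

(** Makes [leF] decidable, so that the vertices whose removal leaves a graph above [G] form a finite
    set. *)
Lemma leFP (G H : digraph) :
  reflect (leF G H)
    [exists f : {ffun G -> H}, forall u, forall v, edge u v == edge (f u) (f v)].
Proof.
apply: (iffP existsP) => [[f /forallP hf]|[f hf]].
  by exists f => u v; have /forallP/(_ v)/eqP := hf u.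
exists (finfun f); apply/forallP => u; apply/forallP => v.
by rewrite !ffunE hf.
Qed.

Lemma induced_val_embedding (G : digraph) (A : {set G}) :
  embedding (val : induced A -> G).
Proof. by split=> //; apply: val_inj. Qed.

Lemma leF_induced_val (G : digraph) (A : {set G}) : leF (induced A) G.
Proof. by exists val. Qed.

Lemma leF_induced (G H : digraph) (f : G -> H) (A : {set H}) :
  full_hom f -> (forall u, f u \in A) -> leF G (induced A).
Proof. by move=> hf fA; exists (fun u => Sub (f u) (fA u) : induced A). Qed.

Lemma card_remove_vertex (G : digraph) (x : G) : #|remove_vertex x|.+1 = #|G|.
Proof.
rewrite card_sig (cardD1 x predT) inE add1n; congr _.+1.
by apply: eq_card => u; rewrite !inE andbT.
Qed.

Lemma full_hom_twins (G H : digraph) (f : G -> H) (u v : G) :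
  full_hom f -> f u = f v -> twins u v.
Proof. by move=> hf fuv w; rewrite !hf fuv. Qed.

Lemma twin_free_inj (G H : digraph) (f : G -> H) :
  twin_free G -> full_hom f -> injective f.
Proof. by move=> tfG hf u v /(full_hom_twins hf)/tfG. Qed.

Lemma twin_free_leF_card (G H : digraph) : twin_free G -> leF G H -> #|G| <= #|H|.
Proof. by move=> tfG [f hf]; apply: leq_card (twin_free_inj tfG hf). Qed.

Definition fold (G : digraph) (u v w : G) : G := if w == u then v else w.

Lemma fold_full_hom (G : digraph) (u v : G) :
  twins u v -> full_hom (fold u v).
Proof.
move=> tw w1 w2; rewrite /fold.
have e1 w : edge v w = edge u w by case: (tw w).
have e2 w : edge w v = edge w u by case: (tw w).
by case: eqP => [->|_]; case: eqP => [->|_]; rewrite ?e1 ?e2.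
Qed.

Lemma leF_remove_twin (G : digraph) (u v : G) :
  u <> v -> twins u v -> leF G (remove_vertex u).
Proof.
move=> /eqP neq_uv tw; apply: (leF_induced (fold_full_hom tw)) => w.
by rewrite !inE /fold; case: (eqVneq w u) => // _; rewrite eq_sym.
Qed.

(** Folding one twin onto the other would give an equivalent graph with one vertex fewer. *)
Lemma F_core_twin_free (G : digraph) : F_core G -> twin_free G.
Proof.
move=> coreG u v tw; apply/eqP/negP => /negP/eqP neq_uv.
have := coreG (remove_vertex u) (conj (leF_remove_twin neq_uv tw)
                                      (leF_induced_val _)).
by rewrite -(card_remove_vertex u) ltnn.
Qed.

Lemma embedding_isomorphic (G H : digraph) (f : G -> H) :
  embedding f -> #|H| <= #|G| -> isomorphic G H.
Proof. by move=> [f_inj hf] leHG; exists f; split=> //; apply: inj_card_bij. Qed.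

Lemma isomorphic_card (G H : digraph) : isomorphic G H -> #|G| = #|H|.
Proof. by move=> [f [bij_f _]]; apply: bij_eq_card bij_f. Qed.

Lemma isomorphic_eqF (G H : digraph) : isomorphic G H -> eqF G H.
Proof.
move=> [f [[g fK gK] hf]]; split; first by exists f.
by exists g => u v; rewrite hf !gK.
Qed.

Lemma leE_ltn_card (G H : digraph) :
  class_lt isomorphic leE G H -> #|G| < #|H|.
Proof.
move=> [[f emb_f] niso]; rewrite ltnNge; apply/negP => leHG.
exact: niso (embedding_isomorphic emb_f leHG).
Qed.

Lemma exists_twin_free_remove_vertex (G H : digraph) (x : H) :
  twin_free H -> leF G (remove_vertex x) ->
  exists2 v : H, twin_free (remove_vertex v) & leF G (remove_vertex v).
Proof.
move=> tfH leGHx.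
pose S := [set v : H | [exists f : {ffun G -> remove_vertex v},
  forall u, forall w, edge u w == edge (f u) (f w)]].
have inS v : leF G (remove_vertex v) -> v \in S by move=> /leFP; rewrite inE.
have S_gt0 : 0 < #|S| <= #|S|.
  by rewrite leqnn andbT; apply/card_gt0P; exists x; apply: inS.
(* Recording both directions makes vertices with equal rows twins. [S] serves both as the rows and
   as the candidate columns. *)
pose r (a u : H) := (edge a u, edge u a).
have r_inj : {in S &, forall a b, r a =1 r b -> a = b}.
  by move=> a b _ _ eq_r; apply: tfH => w; have [-> ->] := eq_r w.
have [v Sv sep_v] := bondy S_gt0 r_inj.
have leGHv : leF G (remove_vertex v) by apply/leFP; move: Sv; rewrite inE.
have twinS (a b : remove_vertex v) : a <> b -> twins a b -> val a \in S.
  move=> neq_ab tw; apply: inS; apply: leF_trans leGHv _.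
  (* [h] maps [H - v] into [H - v - a]; followed by the two inclusions it reaches [H] and misses
     [a]. *)
  have [h hh] := leF_remove_twin neq_ab tw.
  apply: (leF_induced (f := fun u => val (val (h u)))) => // u.
  by have := valP (h u); rewrite !inE.
exists v => // a b tw; apply/eqP/negP => /negP/eqP neq_ab.
apply: (neq_ab); apply: val_inj; apply: sep_v; first exact: twinS tw.
  apply: (twinS b a) => [eq_ba|w]; first exact: neq_ab.
  by have [-> ->] := tw w.
(* Twins in [H - v] are compared at every column but [v], the one that [sep_v] exempts. *)
move=> u neq_uv; have uP : u \in [set~ v] by rewrite !inE.
by have [/= e1 e2] := tw (Sub u uP); rewrite /r e1 e2.
Qed.

Lemma F_gap_remove_vertex (G H : digraph) :
  twin_free G -> twin_free H -> F_gap G H ->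
  exists x : H, isomorphic G (remove_vertex x).
Proof.
move=> tfG tfH [[[f hf] neqGH] nbetween].
have f_inj := twin_free_inj tfG hf.
(* A surjective [f], being injective, would be an isomorphism. *)
have [x fx] : exists x, x \notin codom f.
  apply/existsP; apply: contra_notT neqGH => /existsPn onto.
  apply: isomorphic_eqF; apply: (embedding_isomorphic (f := f)) => //.
  rewrite -(card_codom f_inj); apply: subset_leq_card; apply/subsetP => y _.
  by have := onto y; rewrite negbK.
have leGHx : leF G (remove_vertex x).
  apply: (leF_induced hf) => u; rewrite !inE.
  by apply: contraNneq fx => <-; apply: codom_f.
have [v tfHv leGHv] := exists_twin_free_remove_vertex tfH leGHx.
exists v; have [g hg] := leGHv.
apply: (embedding_isomorphic (f := g)); first by split; first exact: twin_free_inj.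
(* A larger [H - v] would lie strictly between: twin-free graphs have no full homomorphism to
   smaller graphs. *)
rewrite leqNgt; apply/negP => ltGHv; apply: nbetween.
exists (remove_vertex v); split; split=> //.
- by move=> [_ /(twin_free_leF_card tfHv)]; rewrite leqNgt ltGHv.
- exact: leF_induced_val.
- by move=> [_ /(twin_free_leF_card tfH)]; rewrite -(card_remove_vertex v) ltnn.
Qed.

(** Any choice of preimages is a full homomorphism back to [Z], since [f] preserves and reflects
    edges. *)
Lemma eqF_image (Z H : digraph) (f : Z -> H) :
  full_hom f -> eqF Z (induced [set y in codom f]).
Proof.
move=> hf; split; first by apply: (leF_induced (f := f)) => // u; rewrite inE codom_f.
have im_f (y : induced [set y in codom f]) : val y \in codom f.
  by have := valP y; rewrite inE.
by exists (fun y => iinv (im_f y)) => y z; rewrite hf !f_iinv.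
Qed.

Theorem theorem5p5p6 (G H : digraph) (coreG : F_core G) (coreH : F_core H) :
  (F_gap G H -> exists x : H, isomorphic G (remove_vertex x)) /\
  (F_gap G H <-> E_gap G H).
Proof.
have [tfG tfH] := (F_core_twin_free coreG, F_core_twin_free coreH).
have gap_remove := F_gap_remove_vertex tfG tfH.
split=> //; split=> [gapGH | [[[f emb_f] nisoGH] nbetween]].
  have [[[f hf] neqGH] _] := gapGH; split.
    split; first by exists f; split; first exact: twin_free_inj.
    by move=> /isomorphic_eqF.
  (* Strict embeddings raise the number of vertices, and [H] has just one more than [G]. *)
  case=> Z [/leE_ltn_card ltGZ /leE_ltn_card ltZH].
  have [x /isomorphic_card cardG] := gap_remove gapGH.
  by have := leq_ltn_trans ltGZ ltZH; rewrite -(card_remove_vertex x) cardG ltnn.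
split.
  split; first by exists f; case: emb_f.
  move=> [_ /(twin_free_leF_card tfH) leHG].
  exact: nisoGH (embedding_isomorphic emb_f leHG).
case=> Z [[leGZ neqGZ] [[g hg] neqZH]]; apply: nbetween.
(* [g] need not be injective, so [Z] is replaced by its image, an equivalent graph that embeds in
   [H]. *)
have [leZI leIZ] := eqF_image hg.
exists (induced [set y in codom g]); split; split.
- have [h hh] := leF_trans leGZ leZI.
  by exists h; split; first exact: twin_free_inj.
- move=> /isomorphic_eqF[_ leIG]; apply: neqGZ; split=> //.
  exact: leF_trans leZI leIG.
- by exists val; apply: induced_val_embedding.
- move=> /isomorphic_eqF[_ leHI]; apply: neqZH; split; first by exists g.
  exact: leF_trans leHI leIZ.
Qed.
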